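(* Let $K$ be a field, let $r,s$ be non negative integers, and let $I(T_{r,s})=(ab,\ ax_1,\dots,ax_r,\ by_1,\dots,by_s)$ be the edge ideal of the double-star graph $T_{r,s}$ in $R=K[a,b,x_1,\dots,x_r,y_1,\dots,y_s]$. Then $I(T_{r,s})$ has a 2-linear resolution.
   Context: The double-star graph $T_{r,s}$ is the tree on the distinct vertices $a,b,x_1,\dots,x_r,y_1,\dots,y_s$ with edges $\{a,b\}$, $\{a,x_i\}$ ($1\le i\le r$), $\{b,y_i\}$ ($1\le i\le s$). A homogeneous ideal $I$ of $R$ (standard grading) has a 2-linear resolution if all its minimal generators have degree 2 and, in its minimal graded free resolution, all nonzero entries of the higher syzygy matrices are of degree 1. *)

(* Defs.v *)
From mathcomp Require Import all_boot all_order all_algebra.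
From mathcomp Require Import mpoly.

Set Implicit Arguments.
Unset Strict Implicit.
Unset Printing Implicit Defensive.

Import GRing.Theory.
Local Open Scope ring_scope.

(* Ideals are Prop-valued predicates: membership need not be decidable. *)

Definition ideal_span (R : comNzRingType) (S : R -> Prop) (p : R) : Prop :=
  exists (m : nat) (c g : 'I_m -> R),
    (forall i, S (g i)) /\ p = \sum_(i < m) c i * g i.

Definition irrelevant_ideal (K : fieldType) (n : nat) : {mpoly K[n]} -> Prop :=
  ideal_span (fun p : {mpoly K[n]} => exists i : 'I_n, p = 'X_i).

(* A complex  ... -> F_1 -> F_0 -> R  of finite free modules over
   R = K[X_0, ..., X_(n-1)].  Elements of F_i are row vectors and maps act by
   right multiplication, so row j of [syz i] is the image in F_i of the j-th
   basis vector of F_(i+1), and [gens j 0] is the image in R of the j-th basis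
   vector of F_0.  That basis vector of F_i has degree [shift j], i.e.
   F_i = \bigoplus_j R(- shift j); natural numbers suffice as degrees in a
   minimal resolution of an ideal of R. *)
Record free_complex (K : fieldType) (n : nat) := FreeComplex {
  rank : nat -> nat;
  shift : forall i, 'I_(rank i) -> nat;
  gens : 'cV[{mpoly K[n]}]_(rank 0);
  syz : forall i, 'M[{mpoly K[n]}]_(rank i.+1, rank i)
}.

Section Resolutions.

Variables (K : fieldType) (n : nat).
Local Notation R := {mpoly K[n]}.
Implicit Types (F : free_complex K n) (I : R -> Prop).

Definition is_free_resolution F I : Prop :=
  [/\ forall p : R, I p <-> exists u : 'rV[R]_(rank F 0), p = (u *m gens F) 0 0,
      forall u : 'rV[R]_(rank F 0),
        u *m gens F = 0 <-> exists v : 'rV[R]_(rank F 1), u = v *m syz F 0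
    & forall (i : nat) (u : 'rV[R]_(rank F i.+1)),
        u *m syz F i = 0 <->
        exists v : 'rV[R]_(rank F i.+2), u = v *m syz F i.+1].

(* All maps are homogeneous of degree 0.  The comparison of shifts is needed
   because [-] is truncated. *)
Definition is_graded F : Prop :=
  (forall j : 'I_(rank F 0), gens F j 0 \is (shift j).-homog) /\
  (forall (i : nat) (j : 'I_(rank F i.+1)) (k : 'I_(rank F i)),
     syz F i j k != 0 ->
     (shift k <= shift j)%N /\ syz F i j k \is (shift j - shift k).-homog).

Definition is_minimal F : Prop :=
  forall (i : nat) (j : 'I_(rank F i.+1)) (k : 'I_(rank F i)),
    irrelevant_ideal (syz F i j k).

Definition minimal_graded_free_resolution F I : Prop :=
  [/\ is_free_resolution F I, is_graded F & is_minimal F].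

(* A minimal graded free resolution is unique up to graded isomorphism, and both
   conditions below only depend on its shifts, so it does not matter which one
   is chosen.  In it, the entries of [gens F] form a minimal system of
   generators of I. *)
Definition has_2_linear_resolution I : Prop :=
  exists F : free_complex K n,
    [/\ minimal_graded_free_resolution F I,
        forall j : 'I_(rank F 0), gens F j 0 != 0 /\ gens F j 0 \is 2.-homog
      & forall (i : nat) (j : 'I_(rank F i.+1)) (k : 'I_(rank F i)),
          syz F i j k != 0 -> syz F i j k \is 1.-homog].

Definition edge_ideal (e : rel 'I_n) : R -> Prop :=
  ideal_span (fun p : R => exists u v : 'I_n, e u v /\ p = 'X_u * 'X_v).

End Resolutions.

Section DoubleStar.

Variables r s : nat.

Definition ds_a : 'I_(2 + r + s) := lshift s (lshift r ord0).
Definition ds_b : 'I_(2 + r + s) := lshift s (lshift r ord_max).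
Definition ds_x (i : 'I_r) : 'I_(2 + r + s) := lshift s (rshift 2 i).
Definition ds_y (j : 'I_s) : 'I_(2 + r + s) := rshift (2 + r) j.

Definition ds_arc : rel 'I_(2 + r + s) := fun u v =>
  [|| (u == ds_a) && (v == ds_b),
      [exists i, (u == ds_a) && (v == ds_x i)]
    | [exists j, (u == ds_b) && (v == ds_y j)]].

(* The double-star graph T_(r,s) as a symmetric adjacency relation. *)
Definition double_star : rel 'I_(2 + r + s) := fun u v =>
  ds_arc u v || ds_arc v u.

Lemma double_star_sym : ssrbool.symmetric double_star.
Proof. by move=> u v; rewrite /double_star orbC. Qed.

Lemma double_star_irr : irreflexive double_star.
Proof.
move=> u; rewrite /double_star orbb /ds_arc; apply/negP.
case/or3P=> [|/existsP[i]|/existsP[j]] /andP[/eqP->] /eqP /(congr1 val) //=.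
Qed.

(* I(T_(r,s)) = (ab, ax_1, ..., ax_r, by_1, ..., by_s) *)
Lemma edge_ideal_double_star (K : fieldType) (p : {mpoly K[2 + r + s]}) :
  edge_ideal double_star p <->
  ideal_span (fun q : {mpoly K[2 + r + s]} =>
    [\/ q = 'X_ds_a * 'X_ds_b,
        exists i, q = 'X_ds_a * 'X_(ds_x i)
      | exists j, q = 'X_ds_b * 'X_(ds_y j)]) p.
Proof.
split=> -[m [c [g [Hg ->]]]]; exists m, c, g; split=> // k.
  have arcP u v : ds_arc u v ->
    [\/ 'X_u * 'X_v = 'X_ds_a * 'X_ds_b :> {mpoly K[2 + r + s]},
        exists i, 'X_u * 'X_v = 'X_ds_a * 'X_(ds_x i) :> {mpoly K[2 + r + s]}
      | exists j, 'X_u * 'X_v = 'X_ds_b * 'X_(ds_y j) :> {mpoly K[2 + r + s]}].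
    case/or3P=> [|/existsP[i]|/existsP[j]] /andP[/eqP-> /eqP->].
    - by constructor 1.
    - by constructor 2; exists i.
    - by constructor 3; exists j.
  have [u [v [/orP[uv|vu] ->]]] := Hg k; first exact: arcP.
  by rewrite mulrC; exact: arcP.
case: (Hg k) => [->|[i ->]|[j ->]].
- by exists ds_a, ds_b; rewrite /double_star /ds_arc !eqxx.
- exists ds_a, (ds_x i); split=> //; apply/orP; left; apply/or3P.
  by constructor 2; apply/existsP; exists i; rewrite !eqxx.
- exists ds_b, (ds_y j); split=> //; apply/orP; left; apply/or3P.
  by constructor 3; apply/existsP; exists j; rewrite !eqxx.
Qed.

End DoubleStar.

Arguments edge_ideal K {n} e _.
Arguments double_star r s _ _ : clear implicits.

(* Main.v *)
Require Import Defs.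
From mathcomp Require Import all_boot all_order all_algebra.
From mathcomp Require Import mpoly.

(** The edge ideal of a double star has linear quotients.  Take its generators
    in the order ab, ax_1, ..., ax_r, by_1, ..., by_s, and write the colon of
    the ideal of the earlier generators by the next one:
      (ab, ax_1, ..., ax_(i-1)) : ax_i = (b, x_1, ..., x_(i-1)),
      (ab, ax_1, ..., ax_r, by_1, ..., by_(j-1)) : by_j = (a, y_1, ..., y_(j-1)).
    All these colon ideals are generated by variables, and this suffices: if I
    has a d-linear resolution, m is homogeneous of degree d and I : m has a
    1-linear resolution, then I + (m) has a d-linear resolution
    ([linear_quotient]).  The same principle with d = 1 shows that an ideal
    generated by variables is linear, because
    (x_1, ..., x_(i-1)) : x_i = (x_1, ..., x_(i-1)).

    The textbook proof of the principle is the mapping cone of a comparison map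
    between two resolutions.  Here no comparison map is built: linearity is a
    property [linear_upto] of a submodule M of a free module R^k, defined by
    recursion: M is the row space of a matrix of forms of degree d whose
    kernel is linear in degree 1.  The kernel of the presentation of I + (m) is
    an extension of I : m by the kernel of the presentation of I, and linearity
    is stable under such extensions; this is [horseshoe], where one step of the
    recursion stacks a presentation of the submodule on a homogeneous lift of a
    presentation of the quotient.  Unfolding the recursion gives the matrices of
    a resolution.  It is automatically minimal: the syzygies are linear
    forms, and no generator vanishes because a constant vector is not a
    combination of linear syzygies.

    Colons by monomials are computed on exponents: an ideal spanned by monomials
    consists of the polynomials all of whose monomials are divisible by one of
    the generators. *)

Set Implicit Arguments.
Unset Strict Implicit.
Unset Printing Implicit Defensive.

Import GRing.Theory.
Local Open Scope ring_scope.

Definition homog_mx (K : fieldType) (n d k l : nat)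
    (A : 'M[{mpoly K[n]}]_(k, l)) : Prop :=
  forall i j, A i j \is d.-homog.

(** * Homogeneous components and linear forms *)

Section HomogeneousParts.

Variables (K : fieldType) (n : nat).
Local Notation R := {mpoly K[n]}.

Lemma pihomogM_homog d e (p q : R) :
  q \is e.-homog -> pihomog mdeg (d + e)%N (p * q) = pihomog mdeg d p * q.
Proof.
move=> hq; set k := (mmeasure mdeg p + d.+1)%N.
have dk : (d < k)%N by rewrite /k ltn_addl.
have {1}-> : p = \sum_(i < k) pihomog mdeg i p.
  by apply: pihomog_partitionE; rewrite leq_addr.
rewrite mulr_suml linear_sum /= (bigD1 (Ordinal dk)) //= big1 ?addr0.
  by rewrite pihomog_dE // dhomogM // pihomogP.
move=> i ne_id; apply: (@pihomog_ne0 _ _ _ (i + e)%N); first by rewrite eqn_add2r.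
by rewrite dhomogM // pihomogP.
Qed.

(** Kernels and images of homogeneous matrices are graded: this is what makes
    it possible to replace a lift by one of its homogeneous components. *)
Lemma pihomog_mulmx d e k l m (C : 'M[R]_(k, l)) (D : 'M[R]_(l, m)) :
  homog_mx e D ->
  map_mx (pihomog mdeg (d + e)%N) (C *m D) = map_mx (pihomog mdeg d) C *m D.
Proof.
move=> hD; apply/matrixP=> i j; rewrite !mxE linear_sum /=.
by apply: eq_bigr => t _; rewrite mxE pihomogM_homog.
Qed.

Lemma homog_mulmx d e k l m (C : 'M[R]_(k, l)) (D : 'M[R]_(l, m)) :
  homog_mx d C -> homog_mx e D -> homog_mx (d + e)%N (C *m D).
Proof. by move=> hC hD i j; rewrite mxE rpred_sum // => t _; apply: dhomogM. Qed.

Lemma map_pihomog_id d k l (C : 'M[R]_(k, l)) :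
  homog_mx d C -> map_mx (pihomog mdeg d) C = C.
Proof. by move=> hC; apply/matrixP=> i j; rewrite mxE pihomog_dE. Qed.

Lemma homog1_irrelevant (p : R) : p \is 1.-homog -> irrelevant_ideal p.
Proof.
move=> hp; exists n, (fun i => (p@_U_(i))%:MP), (fun i => 'X_i).
split=> [i|]; first by exists i.
apply/mpolyP=> m; rewrite linear_sum /=.
under eq_bigr do rewrite mcoeffCM mcoeffX.
case: (mdeg1P m) => [[j /eqP->]|nU].
  rewrite (bigD1 j) //= eqxx mulr1 big1 ?addr0 // => i ne_ij.
  by rewrite eq_mnm1 (negbTE ne_ij) mulr0.
rewrite big1 => [|i _].
  apply: (dhomog_nemf_coeff hp).
  by apply/negP=> /mdeg1P.
by case: eqP => [Um|]; rewrite ?mulr0 //; case: nU; exists i; rewrite Um.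
Qed.

End HomogeneousParts.

(** * Submodules with a linear resolution *)

Section LinearModules.

Variables (K : fieldType) (n : nat).
Local Notation R := {mpoly K[n]}.

(** The submodule M of R^k has a linear resolution generated in degree d that
    stops after at most N steps.  The basis of R^k is in degree 0, so that d is
    the degree of the entries of the first matrix; each later matrix has linear
    entries, whence the 1 in the recursive call.  The bound N makes the
    definition, and the proofs by induction, structurally recursive. *)
Fixpoint linear_upto (N d : nat) (k : nat) (M : 'rV[R]_k -> Prop) : Prop :=
  if N is N'.+1 then
    exists (l : nat) (A : 'M[R]_(l, k)),
      [/\ homog_mx d A, forall u, M u <-> exists v, u = v *m A
        & linear_upto N' 1 (fun v : 'rV[R]_l => v *m A = 0)]
  else forall u, M u <-> u = 0.

Lemma linear_upto_ext N d k (M M' : 'rV[R]_k -> Prop) :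
  (forall u, M u <-> M' u) -> linear_upto N d M -> linear_upto N d M'.
Proof.
case: N => [|N] eqM /=; first by move=> M0 u; rewrite -eqM.
by case=> l [A [hA imA kerA]]; exists l, A; split=> // u; rewrite -eqM.
Qed.

(** A resolution that stops can be prolonged by free modules of rank 0, so that
    two resolutions can be given the same length. *)
Lemma linear_uptoS N d k (M : 'rV[R]_k -> Prop) :
  linear_upto N d M -> linear_upto N.+1 d M.
Proof.
elim: N d k M => [|N IHN] d k M.
  move=> M0; exists 0%N, 0; split=> [[]//|u|u].
    by rewrite M0; split=> [->|[v ->]]; [exists 0|]; rewrite mulmx0.
  by rewrite mulmx0 [u]thinmx0.
case=> l [A [hA imA kerA]]; exists l, A; split=> //.
exact: IHN kerA.
Qed.

Lemma linear_upto_leq N N' d k (M : 'rV[R]_k -> Prop) :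
  (N <= N')%N -> linear_upto N d M -> linear_upto N' d M.
Proof.
move=> /subnK <- linM; elim: (N' - N)%N => // t; exact: linear_uptoS.
Qed.

(** The kernel of the stacked matrix is an extension: its elements (u | 0) form
    the kernel of D1, and its projection to the last k2 coordinates is the colon
    module of the v with v D2 in the row space of D1.  Let A and B present these
    two modules.  A lift (- C | B) of the rows of B to the stacked kernel can be
    chosen homogeneous, and block_mx A 0 (- C) B presents the stacked kernel.
    Its kernel has the same shape, with D1 and D2 replaced by (A | 0) and
    (- C | B): the new submodule is the kernel of A, and the new colon module is
    the kernel of B, since v B = 0 forces v C to lie in the kernel of D1, that
    is, in the row space of A.  So the induction goes on. *)
Lemma horseshoe N d e k1 k2 l (D1 : 'M[R]_(k1, l)) (D2 : 'M[R]_(k2, l)) :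
  homog_mx e D1 -> homog_mx e D2 ->
  linear_upto N d (fun u => u *m D1 = 0) ->
  linear_upto N d (fun v => exists u, v *m D2 = u *m D1) ->
  linear_upto N d (fun w => w *m col_mx D1 D2 = 0).
Proof.
elim: N d e k1 k2 l D1 D2 => [|N IHN] d e k1 k2 l D1 D2 hD1 hD2 /=.
  move=> ker0 colon0 w; split=> [|->]; last by rewrite mul0mx.
  rewrite -[w]hsubmxK mul_row_col; set u := lsubmx w; set v := rsubmx w.
  move=> uv0; have v0 : v = 0.
    apply/colon0; exists (- u).
    by apply/eqP; rewrite mulNmx -addr_eq0 addrC uv0.
  have u0 : u = 0 by apply/ker0; move: uv0; rewrite v0 mul0mx addr0.
  by rewrite u0 v0 row_mx0.
case=> l1 [A [hA imA kerA]] [l2 [B [hB imB kerB]]].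
have AD1 : A *m D1 = 0.
  apply/row_matrixP=> i; rewrite row0 row_mul; apply/imA.
  by exists (delta_mx 0 i); rewrite rowE.
have [C [hC BD2]] : exists C : 'M[R]_(l2, k1),
    homog_mx d C /\ B *m D2 = C *m D1.
  have liftB i : exists c : 'rV[R]_k1, row i B *m D2 == c *m D1.
    have [c Bc] : exists u, row i B *m D2 = u *m D1.
      by apply/imB; exists (delta_mx 0 i); rewrite rowE.
    by exists c; apply/eqP.
  pose C0 := \matrix_(i < l2) xchoose (liftB i).
  have BC0 : B *m D2 = C0 *m D1.
    apply/row_matrixP=> i; rewrite !row_mul rowK.
    exact/eqP/(xchooseP (liftB i)).
  (* B D2 is homogeneous of degree d + e, hence only the component of degree d
     of the lift contributes. *)
  exists (map_mx (pihomog mdeg d) C0); split.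
    by move=> i j; rewrite mxE pihomogP.
  rewrite -(pihomog_mulmx d C0 hD1) -BC0 map_pihomog_id //.
  exact: homog_mulmx.
exists (l1 + l2)%N, (col_mx (row_mx A 0) (row_mx (- C) B)).
have h1 : homog_mx d (row_mx A (0 : 'M_(l1, k2))).
  by move=> i j; rewrite mxE; case: split => t; rewrite ?mxE ?rpred0.
have h2 : homog_mx d (row_mx (- C) B).
  by move=> i j; rewrite mxE; case: split => t; rewrite ?mxE ?rpredN.
split.
- by move=> i j; rewrite mxE; case: split => t.
- move=> w; split=> [|[z ->]].
    rewrite -[w]hsubmxK mul_row_col; set u := lsubmx w; set v := rsubmx w.
    move=> /eqP; rewrite addr_eq0 => /eqP uv.
    have [y vE] : exists y, v = y *m B.
      by apply/imB; exists (- u); rewrite mulNmx uv opprK.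
    have [x uE] : exists x, u + y *m C = x *m A.
      apply/imA; rewrite mulmxDl uv vE -!mulmxA BD2.
      by rewrite addNr.
    exists (row_mx x y); rewrite mul_row_col !mul_mx_row mulmx0 add_row_mx.
    by rewrite add0r -vE -uE mulmxN addrK.
  rewrite -[z]hsubmxK mul_row_col !mul_mx_row mulmx0 add_row_mx add0r.
  rewrite mul_row_col mulmxDl -!mulmxA AD1 mulmx0 add0r mulNmx mulmxN BD2.
  by rewrite addNr.
apply: (IHN 1%N d) => //.
  apply: linear_upto_ext kerA => u.
  rewrite mul_mx_row mulmx0; split=> [->|]; first by rewrite row_mx0.
  by rewrite -row_mx0 => /eq_row_mx[].
apply: linear_upto_ext kerB => y; split=> [yB|[x]].
  have [x yC] : exists x, y *m C = x *m A.
    by apply/imA; rewrite -mulmxA -BD2 mulmxA yB mul0mx.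
  by exists (- x); rewrite !mul_mx_row mulmx0 yB mulmxN yC mulNmx.
by rewrite !mul_mx_row mulmx0 => /eq_row_mx[].
Qed.

(** Ideals are submodules of R^1. *)
Definition linear_ideal (d : nat) (I : R -> Prop) : Prop :=
  exists N, linear_upto N d (fun u : 'rV[R]_1 => I (u 0 0)).

Lemma linear_ideal_ext d (I I' : R -> Prop) :
  (forall p, I p <-> I' p) -> linear_ideal d I -> linear_ideal d I'.
Proof.
move=> eqI [N linI]; exists N; apply: linear_upto_ext linI => u; exact: eqI.
Qed.

Lemma linear_ideal0 d : linear_ideal d (fun p => p = 0).
Proof.
exists 0%N => u; split=> [u0|->]; last by rewrite mxE.
by rewrite [u]mx11_scalar u0 raddf0.
Qed.

(** If A presents I, then the column A followed by the entry m presents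
    I' = I + (m), and the colon module that [horseshoe] needs for its kernel is
    I : m. *)
Lemma linear_quotient d (I I' : R -> Prop) (m : R) :
  m \is d.-homog ->
  (forall p, I' p <-> exists q, I (p - q * m)) ->
  linear_ideal d I -> linear_ideal 1 (fun q => I (q * m)) ->
  linear_ideal d I'.
Proof.
move=> hm defI' [N1 linI] [N2 linJ]; set N := maxn N1 N2.
have := linear_uptoS (linear_upto_leq (leq_maxl N1 N2) linI).
have {linI} linJ := linear_upto_leq (leq_maxr N1 N2) linJ.
rewrite -/N in linJ * => -[k [A [hA imA kerA]]].
have hm1 : homog_mx d (m%:M : 'M_1).
  by move=> i j; rewrite !ord1 mxE.
exists N.+1, (k + 1)%N, (col_mx A m%:M); split.
- by move=> i j; rewrite mxE; case: split.
- move=> w; rewrite defI'; split=> [[q Iq]|[z ->]].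
    have [x xA] : exists x, w - q%:M *m m%:M = x *m A.
      by apply/imA; rewrite -scalar_mxM !mxE.
    by exists (row_mx x q%:M); rewrite mul_row_col -xA subrK.
  exists (rsubmx z 0 0).
  have /imA : exists x, lsubmx z *m A = x *m A by exists (lsubmx z).
  rewrite -{2}[z]hsubmxK mul_row_col mul_mx_scalar.
  by rewrite !mxE mulrC addrK.
apply: horseshoe hA hm1 kerA _.
by apply: linear_upto_ext linJ => v; rewrite -imA mul_mx_scalar mxE mulrC.
Qed.

End LinearModules.

(** * From linear presentations to a minimal resolution *)

Section FromTowersToResolutions.

Variables (K : fieldType) (n : nat).
Local Notation R := {mpoly K[n]}.

(** The rank of the target of the i-th matrix of a tower over R^k.  The case
    analysis makes these ranks agree by computation when a matrix is put below
    a tower, so that no cast is needed. *)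
Definition prev_rank (k : nat) (rk : nat -> nat) (i : nat) : nat :=
  if i is j.+1 then rk j else k.

Lemma linear_upto_tower N d k (M : 'rV[R]_k -> Prop) :
  linear_upto N d M ->
  exists (rk : nat -> nat) (D : forall i, 'M[R]_(rk i, prev_rank k rk i)),
    [/\ homog_mx d (D 0%N), forall i, homog_mx 1 (D i.+1),
        forall u, M u <-> exists v, u = v *m D 0%N
      & forall i (u : 'rV_(rk i)), u *m D i = 0 <-> exists v, u = v *m D i.+1].
Proof.
elim: N d k M => [|N IHN] d k M /=.
  move=> M0; exists (fun=> 0%N), (fun=> 0); split=> [[]//|i []//|u|i u].
    by rewrite M0; split=> [->|[v ->]]; [exists 0|]; rewrite mulmx0.
  by rewrite mulmx0; split=> // _; exists 0; rewrite [LHS]thinmx0 mulmx0.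
case=> l [A [hA imA /IHN[rk [D [hD0 hDS imD kerD]]]]].
pose rk' := prev_rank l rk.
pose D' i : 'M[R]_(rk' i, prev_rank k rk' i) :=
  match i return 'M[R]_(rk' i, prev_rank k rk' i) with
  | 0%N => A
  | j.+1 => D j
  end.
exists rk', D'; split=> //; first by case.
by case=> [u|i u]; [apply: imD | apply: kerD].
Qed.

(** A zero row of A would put a basis vector in the kernel of A, hence in the
    row space of B, where all constant terms vanish. *)
Lemma row_tower_neq0 l k k' (B : 'M[R]_(k', l)) (A : 'M[R]_(l, k)) j :
  homog_mx 1 B ->
  (forall u : 'rV_l, u *m A = 0 -> exists v, u = v *m B) -> row j A != 0.
Proof.
move=> hB kerA; apply/negP=> /eqP; rewrite rowE => /kerA[v].
move/(congr1 (fun u : 'rV_l => (u 0 j)@_0%MM)).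
rewrite !mxE !eqxx mcoeff1 eqxx linear_sum big1 => [/eqP|i _ /=].
  by rewrite oner_eq0.
rewrite rmorphM /= (dhomog_nemf_coeff (hB i j)) ?mulr0 //.
by rewrite /= mdeg0.
Qed.

(** The basis of the i-th free module is in degree i + 2, as all the syzygies
    are linear. *)
Lemma linear_ideal_resolution (I : R -> Prop) :
  linear_ideal 2 I -> has_2_linear_resolution I.
Proof.
case=> N /linear_upto_tower[rk [D [hD0 hDS imD kerD]]].
exists (@FreeComplex K n rk (fun i _ => i.+2) (D 0%N) (fun i => D i.+1)).
split=> [|j|i j k _]; last exact: hDS.
- split=> [|| i j k]; last exact/homog1_irrelevant/hDS.
  + split=> [p|u|i u]; [|exact: (kerD 0%N u)|exact: (kerD i.+1 u)].
    have := imD (const_mx p); rewrite mxE => ->.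
    split=> -[u uE]; exists u; first by rewrite -uE mxE.
    by apply/rowP=> t; rewrite ord1 -uE mxE.
  + split=> [j|i j k _]; first exact: hD0.
    by split; rewrite /= ?leqnSn // subSnn; apply: hDS.
- split; last exact: hD0.
  have := row_tower_neq0 (A := D 0%N) j (hDS 0%N) (fun u => (kerD 0%N u).1).
  by apply: contra => /eqP Dj0; apply/eqP/rowP=> t; rewrite ord1 !mxE.
Qed.

End FromTowersToResolutions.

(** * Monomial ideals with linear quotients *)

Section MonomialIdeals.

Variables (K : fieldType) (n : nat).
Local Notation R := {mpoly K[n]}.
Implicit Types (s t : seq 'X_{1..n}) (g m : 'X_{1..n}) (p q : R).

(** The ideal spanned by the monomials with exponents in s, described by
    supports: [monomial_ideal_span] is the link with the generators. *)
Definition monomial_ideal s p : Prop :=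
  forall m, p@_m != 0 -> has (fun g => g <= m)%MM s.

Lemma monomial_ideal_span s p :
  ideal_span (fun q : R => exists2 g, g \in s & q = 'X_[g]) p <->
  monomial_ideal s p.
Proof.
split=> [[l [c [e [he ->]]]] m|sp].
  rewrite linear_sum /= => nz.
  have [i] : exists i, (c i * e i)@_m != 0.
    apply/existsP; apply: contraNT nz; rewrite negb_exists => /forallP c0.
    by rewrite big1 // => i _; apply/eqP; move: (c0 i); rewrite negbK.
  have [g gs ->] := he i; rewrite -mcoeff_msupp (perm_mem (msuppMX _ _)).
  by case/mapP=> m' _ ->; apply/hasP; exists g => //; apply: lem_addr.
pose gen m := nth 0%MM s (find (fun g => g <= m)%MM s).
pose mon (i : 'I_(size (msupp p))) := nth 0%MM (msupp p) i.
have hasm i : has (fun g => g <= mon i)%MM s.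
  by apply: sp; rewrite -mcoeff_msupp mem_nth.
exists (size (msupp p)), (fun i => p@_(mon i) *: 'X_[mon i - gen (mon i)]),
  (fun i => 'X_[gen (mon i)]).
split=> [i|]; first by exists (gen (mon i)); rewrite // mem_nth -?has_find.
rewrite {1}[p]mpolyE (big_nth 0%MM) big_mkord; apply: eq_bigr => i _.
by rewrite -scalerAl -mpolyXD submK // (nth_find 0%MM (hasm i)).
Qed.

Lemma monomial_idealMX s p g :
  monomial_ideal s (p * 'X_[g]) <->
  (forall m, p@_m != 0 -> has (fun h => h <= m + g)%MM s).
Proof.
split=> sp m; first by move=> pm; apply: sp; rewrite addmC mcoeffMX.
rewrite -mcoeff_msupp (perm_mem (msuppMX _ _)) => /mapP[m' m'p ->].
by rewrite addmC; apply: sp; rewrite -mcoeff_msupp.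
Qed.

Lemma monomial_ideal_cons g s p :
  monomial_ideal (g :: s) p <-> exists q, monomial_ideal s (p - q * 'X_[g]).
Proof.
split=> [sp|[q sp] m pm].
  (* q takes the monomials divisible by g; any other monomial of p is
     divisible by an element of s. *)
  pose q : R := \sum_(m <- msupp p | (g <= m)%MM) p@_m *: 'X_[m - g].
  exists q; have -> : p - q * 'X_[g] =
      \sum_(m <- msupp p | ~~ (g <= m)%MM) p@_m *: 'X_[m].
    rewrite {1}[p]mpolyE (bigID (fun m => g <= m)%MM) /= mulr_suml.
    rewrite addrC; apply/eqP; rewrite subr_eq; apply/eqP; congr (_ + _).
    by apply: eq_bigr => m gm; rewrite -scalerAl -mpolyXD submK.
  move=> m; rewrite linear_sum /= => nz.
  apply: contraNT nz => nsm; rewrite big1_seq // => m' /andP[ngm' pm'].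
  rewrite mcoeffZ mcoeffX; case: eqP => [Em|_]; last by rewrite mulr0.
  have /= := sp m'; rewrite -mcoeff_msupp => /(_ pm').
  by rewrite (negbTE ngm') Em (negbTE nsm).
rewrite /=; case: (boolP (g <= m)%MM) => //= ngm; apply: sp.
rewrite mcoeffB; suff -> : (q * 'X_[g])@_m = 0 by rewrite subr0.
apply/eqP; rewrite mcoeff_eq0 (perm_mem (msuppMX _ _)).
by apply: contra ngm => /mapP[m' _ ->]; apply: lem_addr.
Qed.

(** [linear_quotient] for monomials.  The hypothesis on exponents says that the
    ideal of s, divided by the monomial g, is the ideal of t. *)
Lemma linear_monomial_cons d g s t :
  mdeg g = d ->
  (forall m, has (fun h => h <= m + g)%MM s = has (fun h => h <= m)%MM t) ->
  linear_ideal d (monomial_ideal s) -> linear_ideal 1 (monomial_ideal t) ->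
  linear_ideal d (monomial_ideal (g :: s)).
Proof.
move=> dg colon lin_s lin_t.
apply: (linear_quotient _ (monomial_ideal_cons g s)) lin_s _.
  by rewrite dhomogX; apply/eqP.
apply: linear_ideal_ext lin_t => p; rewrite monomial_idealMX.
by split=> tp m /tp; rewrite colon.
Qed.

Lemma linear_monomial_nil d : linear_ideal d (monomial_ideal [::]).
Proof.
apply: linear_ideal_ext (linear_ideal0 K n d) => p; split=> [-> m|p0].
  by rewrite mcoeff0 eqxx.
by apply/mpolyP=> m; rewrite mcoeff0; apply/eqP/negPn/negP => /p0.
Qed.

Lemma lem_add_cancel m g g1 g2 :
  (g + g1 <= m + (g + g2))%MM = (g1 <= m + g2)%MM.
Proof.
by apply: eq_forallb => i; rewrite !mnmDE addnCA leq_add2l.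
Qed.

Lemma lep1m_addU m i j : i != j -> (U_(j) <= m + U_(i))%MM = (U_(j) <= m)%MM.
Proof. by move=> /negbTE ij; rewrite !lep1mP mnmDE mnm1E ij /= addn0. Qed.

Lemma linear_variables (v : seq 'I_n) :
  uniq v -> linear_ideal 1 (monomial_ideal [seq U_(i)%MM | i <- v]).
Proof.
elim: v => [|i v IHv] /=; first by move=> _; apply: linear_monomial_nil.
case/andP=> iv /IHv lin_v.
apply: (linear_monomial_cons (mdeg1 i) _ lin_v lin_v) => m.
rewrite !has_map; apply: eq_in_has => j jv /=.
by rewrite lep1m_addU //; apply: contraNneq iv => ->.
Qed.

(** The colon of an ideal of edges at a by another edge at a: the common factor
    cancels, and distinct variables are coprime. *)
Lemma has_edges_colon a i (v : seq 'I_n) m : i \notin v ->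
  has (fun h => h <= m + (U_(a) + U_(i)))%MM [seq (U_(a) + U_(j))%MM | j <- v]
  = has (fun h => h <= m)%MM [seq U_(j)%MM | j <- v].
Proof.
move=> iv; rewrite !has_map; apply: eq_in_has => j jv /=.
by rewrite lem_add_cancel lep1m_addU //; apply: contraNneq iv => ->.
Qed.

Lemma linear_star a (v : seq 'I_n) :
  uniq v -> linear_ideal 2 (monomial_ideal [seq (U_(a) + U_(i))%MM | i <- v]).
Proof.
elim: v => [|i v IHv] /=; first by move=> _; apply: linear_monomial_nil.
case/andP=> iv uv; have lin_v := linear_variables uv.
apply: linear_monomial_cons _ _ (IHv uv) lin_v; first by rewrite mdegD !mdeg1.
by move=> m; apply: has_edges_colon.
Qed.

(** The colon of the star of a by an edge by of its leaf b is (a): each edge of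
    the star is divisible by a, which is coprime to by, and the edge ab already
    becomes a. *)
Lemma has_star_colon a b y (v : seq 'I_n) m :
  a != b -> a != y -> b \in v ->
  has (fun h => h <= m + (U_(b) + U_(y)))%MM [seq (U_(a) + U_(i))%MM | i <- v]
  = (U_(a) <= m)%MM.
Proof.
move=> ab ay bv; rewrite lep1mP; apply/hasP/idP=> [[h /mapP[i _ ->]]|ma].
  move/mnm_lepP/(_ a); rewrite !mnmDE !mnm1E eqxx.
  rewrite [b == a]eq_sym [y == a]eq_sym (negbTE ab) (negbTE ay) /= !addn0.
  by case: (m a).
exists (U_(a) + U_(b))%MM; first by apply/mapP; exists b.
rewrite addmC lem_add_cancel lep1mP mnmDE mnm1E [y == a]eq_sym (negbTE ay).
by rewrite /= addn0.
Qed.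

(** The edges at b are added one by one to the star of a.  The colon ideal of
    the step that adds by is generated by the earlier y's, because of the edges
    at b, and by a, because of the star of a. *)
Lemma linear_two_stars a b (v w : seq 'I_n) :
  a != b -> b \in v -> a \notin w -> uniq v -> uniq w ->
  linear_ideal 2 (monomial_ideal ([seq (U_(b) + U_(y))%MM | y <- w] ++
                                  [seq (U_(a) + U_(i))%MM | i <- v])).
Proof.
move=> ab bv + uv; elim: w => [|y w IHw] /=.
  by move=> _ _; apply: linear_star.
rewrite inE negb_or => /andP[ay aw] /andP[yw uw].
have lin_aw : linear_ideal 1 (monomial_ideal [seq U_(i)%MM | i <- a :: w]).
  by apply: linear_variables; rewrite /= aw.
apply: linear_monomial_cons _ _ (IHw aw uw) lin_aw.
  by rewrite mdegD !mdeg1.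
by move=> m; rewrite has_cat has_edges_colon // has_star_colon // orbC.
Qed.

End MonomialIdeals.

(** * The double star *)

Theorem corollary3 (K : fieldType) (r s : nat) :
  has_2_linear_resolution (edge_ideal K (double_star r s)).
Proof.
pose a := ds_a r s; pose b := ds_b r s.
pose v := b :: [seq ds_x s i | i <- enum 'I_r].
pose w := [seq ds_y r j | j <- enum 'I_s].
have ab : a != b by [].
have aw : a \notin w.
  by apply/mapP=> -[j _ /(congr1 val)].
have uv : uniq v.
  rewrite /= map_inj_uniq ?enum_uniq ?andbT.
    by apply/mapP=> -[i _ /(congr1 val)].
  by move=> i j /lshift_inj/rshift_inj.
have uw : uniq w.
  by rewrite map_inj_uniq ?enum_uniq //; apply: rshift_inj.
apply: linear_ideal_resolution.
have := linear_two_stars K ab (mem_head _ _) aw uv uw.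
apply: linear_ideal_ext => p; rewrite edge_ideal_double_star.
rewrite -monomial_ideal_span.
split=> -[l [c [g [hg ->]]]]; exists l, c, g; split=> // k.
  have [h + ->] := hg k; rewrite mem_cat inE.
  case/orP=> [/mapP[_ /mapP[j _ ->] ->]|/orP[/eqP->|]].
  - by constructor 3; exists j; rewrite mpolyXD.
  - by constructor 1; rewrite mpolyXD.
  - case/mapP=> _ /mapP[i _ ->] ->.
    by constructor 2; exists i; rewrite mpolyXD.
have [->|[i ->]|[j ->]] := hg k; rewrite -mpolyXD.
- by exists (U_(a) + U_(b))%MM; rewrite // mem_cat mem_head orbT.
- exists (U_(a) + U_(ds_x s i))%MM => //; rewrite mem_cat; apply/orP; right.
  by apply/mapP; exists (ds_x s i); rewrite // mem_behead ?map_f ?mem_enum.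
- exists (U_(b) + U_(ds_y r j))%MM => //; rewrite mem_cat; apply/orP; left.
  by apply/mapP; exists (ds_y r j); rewrite // map_f ?mem_enum.
Qed.
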